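(* Let $\mathbb{U}$ be a subfield of $\mathbb{R}$ and let $P$ be an $n\times n$ positive stochastic matrix over $\mathbb{U}$. If $P+J_n(I_n-P)$ is positive, then there is a positive doubly stochastic $n\times n$ matrix $Q$ such that $P$ is similar to $Q$ and $P$ is SSE$-\mathbb{U}_+$ to $Q$ through matrices of the same size (i.e. through $n\times n$ matrices).
   Context: A matrix is nonnegative (resp. positive) if all its entries are $\ge 0$ (resp. $>0$). A square matrix is stochastic if it is nonnegative and every row sum is $1$; it is doubly stochastic if both it and its transpose are stochastic. $I_n$ is the $n\times n$ identity matrix and $J_n$ is the $n\times n$ matrix all of whose entries are $\frac1n$. $\mathbb{U}_+$ is the semiring of nonnegative elements of $\mathbb{U}$. For a semiring $\mathcal{R}$ containing $0$ and $1$, square matrices $A,B$ over $\mathcal{R}$ (possibly of different sizes) are elementary strong shift equivalent over $\mathcal{R}$ (ESSE$-\mathcal{R}$) if there exist (possibly rectangular) matrices $U,V$ over $\mathcal{R}$ with $A=UV$, $B=VU$. They are strong shift equivalent over $\mathcal{R}$ (SSE$-\mathcal{R}$) if there is a finite sequence of square matrices $A=A_0,A_1,\ldots,A_l=B$ over $\mathcal{R}$ with $A_i$ ESSE$-\mathcal{R}$ to $A_{i+1}$ for all $0\le i<l$. The strong shift equivalence is ''through matrices of the same size'' if all the $A_i$ have the same size as $A$. *)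

(* Defs.v *)
From HB Require Import structures.
From mathcomp Require Import all_boot all_order all_algebra.
From mathcomp Require Import reals.

Set Implicit Arguments.
Unset Strict Implicit.
Unset Printing Implicit Defensive.

Import Order.TTheory GRing.Theory Num.Theory.
Local Open Scope ring_scope.

Definition mx_nonneg (R : numDomainType) m n (A : 'M[R]_(m, n)) : Prop :=
  forall i j, 0 <= A i j.

Definition mx_positive (R : numDomainType) m n (A : 'M[R]_(m, n)) : Prop :=
  forall i j, 0 < A i j.

Definition stochastic (R : numDomainType) n (A : 'M[R]_n) : Prop :=
  mx_nonneg A /\ forall i, \sum_j A i j = 1.

Definition doubly_stochastic (R : numDomainType) n (A : 'M[R]_n) : Prop :=
  stochastic A /\ stochastic A^T.

Definition J_mx (R : numFieldType) n : 'M[R]_n := const_mx (n%:R^-1).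
Arguments J_mx : clear implicits.

(* The semiring U_+ of nonnegative elements of U. *)
Definition nonneg_part (R : numDomainType) (U : {pred R}) : {pred R} :=
  fun x => (x \in U) && (0 <= x).

Section NonnegPartSemiring.
Variables (R : numDomainType) (U : semiringClosed R).

Fact nonneg_partE x : (x \in nonneg_part U) = (x \in U) && (0 <= x).
Proof. by []. Qed.

Fact nonneg_part_semiring_closed : semiring_closed (nonneg_part U).
Proof.
split; split.
- by rewrite nonneg_partE rpred0 lexx.
- move=> x y; rewrite !nonneg_partE => /andP[Ux x0] /andP[Uy y0].
  by rewrite rpredD // addr_ge0.
- by rewrite nonneg_partE rpred1 ler01.
- move=> x y; rewrite !nonneg_partE => /andP[Ux x0] /andP[Uy y0].
  by rewrite rpredM // mulr_ge0.
Qed.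

HB.instance Definition _ :=
  GRing.isSemiringClosed.Build R (nonneg_part U) nonneg_part_semiring_closed.

End NonnegPartSemiring.

(* A semiring is given as a sub-semiring S of an ambient ring R, and a matrix
   over S as a matrix over R with entries in S. A and B are over S as soon as
   X and Y are. *)
Definition ESSE (R : nzRingType) (S : semiringClosed R) m n
    (A : 'M[R]_m) (B : 'M[R]_n) : Prop :=
  exists (X : 'M[R]_(m, n)) (Y : 'M[R]_(n, m)),
    [/\ X \is a mxOver S, Y \is a mxOver S, A = X *m Y & B = Y *m X].

(* Strong shift equivalence over S through matrices of the same size; the
   values C i with l < i are irrelevant. *)
Definition SSE_same_size (R : nzRingType) (S : semiringClosed R) n
    (A B : 'M[R]_n) : Prop :=
  exists (l : nat) (C : nat -> 'M[R]_n),
    [/\ C 0%N = A, C l = B,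
        forall i, (i <= l)%N -> C i \is a mxOver S
      & forall i, (i < l)%N -> ESSE S (C i) (C i.+1)].

(* For an invertible base change matrix X, A ~_X B means X *m A *m X^-1 = B. *)
Definition similar_over (R : fieldType) (U : divringClosed R) n
    (A B : 'M[R]_n) : Prop :=
  A ~_{in [pred X : 'M[R]_n | (X \in unitmx) && (X \is a mxOver U)]} B.

(* Main.v *)
(* Put J = J_n. The segment C_t = P + t J (I - P), t in [0, 1], joins P to the
   doubly stochastic Q = C_1. If M = 1 y with y a row vector, y 1 = s < 1, then
   conjugating a stochastic A by I - M gives A + M (I - A), and this conjugation
   is an elementary strong shift equivalence over U_+ as soon as M and
   (I - M) A are nonnegative, which holds for small M when A is positive.
   Taking M = J / (m + i + 1) moves C_t from t = i / (m + i) to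
   t = (i + 1) / (m + i + 1); such steps approach Q without reaching it.
   With Z = 1 pi the projection onto the stationary distribution pi of P, the
   matrix M = m / (m + l) (Z + b J) goes backwards, from C_1 = Q to C_t with
   t = l / (m + l), which closes the gap once l is large. The similarity of P
   and Q is the conjugation by I - (J - Z). *)

Require Import Defs.
From HB Require Import structures.
From mathcomp Require Import all_boot all_order all_algebra.
From mathcomp Require Import reals ring.

Set Implicit Arguments.
Unset Strict Implicit.
Unset Printing Implicit Defensive.

Import Order.TTheory GRing.Theory Num.Theory.
Local Open Scope ring_scope.

(** * Archimedean domination, and matrices over a subfield *)

Lemma positive_mx_dominates (R : archiRealFieldType) m n (A B : 'M[R]_(m, n)) :
  mx_positive A -> exists N : nat, forall k : nat, (N <= k)%N ->
    forall i j, B i j <= k%:R * A i j.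
Proof.
move=> A_pos.
(* Summing the bounds of all entries gives one threshold valid for each of them. *)
exists (\sum_i \sum_j Num.bound (`|B i j| / A i j)%R)%N => k le_Nk i j.
apply: le_trans (ler_norm _) _; rewrite -ler_pdivrMr //.
apply: le_trans (ltW (archi_boundP _)) _.
  by rewrite divr_ge0 // ltW.
rewrite ler_nat (leq_trans _ le_Nk) // (bigD1 i) //= (bigD1 j) //=.
by rewrite -addnA leq_addr.
Qed.

Section MatrixOver.
Variables (R : fieldType) (U : divringClosed R).

Lemma det_over n (A : 'M[R]_n) : A \is a mxOver U -> \det A \in U.
Proof.
move=> /mxOverP AU; rewrite /determinant rpred_sum // => s _.
by rewrite rpredMsign rpred_prod.
Qed.

Lemma invmx_over n (A : 'M[R]_n) : A \is a mxOver U -> invmx A \is a mxOver U.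
Proof.
(* For singular [A], [invmx A] is [A] by default; otherwise it is the adjugate divided by the
   determinant. *)
move=> AU; rewrite /invmx; case: ifP => // _.
apply/mxOverP => i j; rewrite !mxE rpredM ?rpredV ?det_over //.
rewrite /cofactor rpredMsign det_over //; apply/mxOverP => k l.
by rewrite !mxE (mxOverP AU).
Qed.

End MatrixOver.

(** * Conjugation by [1%:M - M] as an elementary equivalence *)

Lemma conj_step (R : pzRingType) n (A M : 'M[R]_n) : A *m M = M ->
  (1%:M - M) *m A = (A + M *m (1%:M - A)) *m (1%:M - M).
Proof.
(* Thus the correction [M *m (1%:M - A)] is unchanged by the right factor [1%:M - M]. *)
move=> AM; have E : (1%:M - A) *m (1%:M - M) = 1%:M - A.
  by rewrite mulmxBr mulmx1 mulmxBl mul1mx AM subrr subr0.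
rewrite [RHS]mulmxDl -mulmxA E !mulmxBr mulmxBl mul1mx !mulmx1 AM.
by rewrite addrA subrK.
Qed.

Lemma ESSE_sym (R : nzRingType) (S : semiringClosed R) m n
    (A : 'M[R]_m) (B : 'M[R]_n) : ESSE S A B -> ESSE S B A.
Proof. by move=> [X [Y [XS YS AE BE]]]; exists Y, X. Qed.

Section NonnegOver.
Variables (R : realFieldType) (U : divringClosed R).

Lemma mxOver_nonneg_part m n (A : 'M[R]_(m, n)) :
  A \is a mxOver U -> mx_nonneg A -> A \is a mxOver (nonneg_part U).
Proof.
move=> /mxOverP AU A0; apply/mxOverP => i j.
by rewrite nonneg_partE AU A0.
Qed.

Lemma one_over n : (1%:M : 'M[R]_n) \is a mxOver U.
Proof. by rewrite mxOver_scalar ?rpred0 ?rpred1. Qed.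

(** Since [M *m M = s *: M], the inverse of [1%:M - M] is [1%:M + c *: M] with [c = (1 - s)^-1],
    nonnegative because [s < 1]. This inverse and [(1%:M - M) *m A] are the two factors. *)
Lemma ESSE_step n (A M : 'M[R]_n) (s : R) :
  A \is a mxOver U -> M \is a mxOver U -> s \in U ->
  A *m M = M -> M *m M = s *: M -> s < 1 ->
  mx_nonneg M -> mx_nonneg ((1%:M - M) *m A) ->
  ESSE (nonneg_part U) A (A + M *m (1%:M - A)).
Proof.
move=> AU MU sU AM MM s1 M0 MA0; set c := (1 - s)^-1.
have cE : c - c * s = 1.
  by rewrite -{1}[c]mulr1 -mulrBr mulVf // subr_eq0 eq_sym lt_eqF.
have XK : (1%:M + c *: M) *m (1%:M - M) = 1%:M.
  rewrite mulmxDl mul1mx mulmxBr mulmx1 -scalemxAl MM scalerA -scalerBl cE.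
  by rewrite scale1r subrK.
have cMU : c *: M \is a mxOver U by rewrite mxOverZ // rpredV rpredB ?rpred1.
exists (1%:M + c *: M), ((1%:M - M) *m A); split.
- apply: mxOver_nonneg_part; first by rewrite rpredD ?one_over.
  move=> i j; rewrite !mxE addr_ge0 ?ler0n // mulr_ge0 //.
  by rewrite invr_ge0 subr_ge0 ltW.
- by apply: mxOver_nonneg_part => //; rewrite mxOverM ?rpredB ?one_over.
- by rewrite mulmxA XK mul1mx.
- by rewrite conj_step // -mulmxA (mulmx1C XK) mulmx1.
Qed.

End NonnegOver.

Lemma nonneg_1subZ (R : realFieldType) n (M A : 'M[R]_n) (k : R) :
  0 < k -> (forall i j, (M *m A) i j <= k * A i j) ->
  mx_nonneg ((1%:M - k^-1 *: M) *m A).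
Proof.
move=> k0 MA i j; rewrite mulmxBl mul1mx -scalemxAl [X in 0 <= X]mxE.
by rewrite [X in _ + X]mxE [X in _ - X]mxE subr_ge0 mulrC ler_pdivrMr // mulrC.
Qed.

(** * The uniform matrix [J] *)

Section Uniform.
Variable R : realFieldType.

Lemma J_mx_over (U : divringClosed R) n : J_mx R n \is a mxOver U.
Proof. by rewrite mxOver_const // rpredV rpred_nat. Qed.

Lemma sum_const_inv n (i : 'I_n) : \sum_(j < n) (n%:R^-1 : R) = 1.
Proof.
rewrite sumr_const card_ord -[LHS]mulr_natr mulVf // pnatr_eq0 -lt0n.
exact: leq_ltn_trans (ltn_ord i).
Qed.

Lemma row_sum1_mulJ n (A : 'M[R]_n) :
  (forall i, \sum_j A i j = 1) <-> A *m J_mx R n = J_mx R n.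
Proof.
split=> [A1|AJ i].
  apply/matrixP => i j; rewrite !mxE -[RHS]mul1r -[X in _ = X * _](A1 i).
  rewrite mulr_suml.
  by apply: eq_bigr => k _; rewrite mxE.
have /matrixP/(_ i i) := AJ; rewrite !mxE => E.
have n0 : (n%:R^-1 : R) != 0.
  by rewrite invr_eq0 pnatr_eq0 -lt0n; exact: leq_ltn_trans (ltn_ord i).
apply: (mulIf n0); rewrite mul1r -[RHS]E mulr_suml.
by apply: eq_bigr => k _; rewrite mxE.
Qed.

Lemma J_mx_idem n : J_mx R n *m J_mx R n = J_mx R n.
Proof.
apply/row_sum1_mulJ => i.
by rewrite (eq_bigr (fun=> n%:R^-1)) ?sum_const_inv // => j _; rewrite mxE.
Qed.

Lemma tr_J_mx n : (J_mx R n)^T = J_mx R n.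
Proof. by rewrite trmx_const. Qed.

End Uniform.

(** * The stationary distribution of a positive stochastic matrix *)

Section Stationary.
Variables (R : realFieldType) (n : nat) (P : 'M[R]_n).
Hypotheses (P_pos : mx_positive P) (P1 : forall i, \sum_j P i j = 1).

(** At an index [i] where [x] is maximal, the weighted sum of the gaps [x i 0 - x j 0 >= 0] equals
    [- c]; if it vanishes, positive weights force every gap to vanish. *)
Lemma max_principle (i0 : 'I_n) (x : 'cV[R]_n) (c : R) :
  P *m x = x + const_mx c ->
  c <= 0 /\ (c = 0 -> forall i j, x i 0 = x j 0).
Proof.
move=> Px.
have defect i : \sum_j P i j * (x i 0 - x j 0) = - c.
  have /matrixP/(_ i 0) := Px; rewrite !mxE => Pxi.
  under eq_bigr do rewrite mulrBr.
  by rewrite sumrB Pxi -mulr_suml P1 mul1r opprD addrA subrr add0r.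
case: (@arg_maxP _ _ _ i0 predT (fun i => x i 0)) => // i _ x_le.
have defect_ge0 j : 0 <= P i j * (x i 0 - x j 0).
  by rewrite mulr_ge0 ?(ltW (P_pos _ _)) // subr_ge0; exact: x_le.
split=> [|c0]; first by rewrite -oppr_ge0 -(defect i) sumr_ge0.
suff xE j : x j 0 = x i 0 by move=> k l; rewrite !xE.
have := defect i; rewrite c0 oppr0 => /(psumr_eq0P (fun k _ => defect_ge0 k)).
move=> /(_ j isT)/eqP; rewrite mulf_eq0 gt_eqF //= subr_eq0.
by move=> /eqP ->.
Qed.

Let K := 1%:M - P + J_mx R n.

(** A kernel vector [x] satisfies [P *m x = x + const_mx c], with [c] the mean of [x]. The maximum
    principle for [x] and [- x] gives [c = 0], so [x] is constant with mean zero. *)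
Lemma fundamental_unitmx : K \in unitmx.
Proof.
rewrite -unitmx_tr -row_free_unit; apply: inj_row_free => v vK.
pose x := v^T; have {vK} Kx : K *m x = 0.
  by rewrite -[LHS]trmxK trmx_mul trmxK vK trmx0.
suff x0 : x = 0 by rewrite -[v]trmxK -/x x0 trmx0.
apply/matrixP => i j; rewrite ord1 [RHS]mxE {j}.
pose c := \sum_j n%:R^-1 * x j 0.
have Jx : J_mx R n *m x = const_mx c.
  apply/matrixP => k l; rewrite ord1 !mxE.
  by apply: eq_bigr => j _; rewrite mxE.
have Px : P *m x = x + const_mx c.
  apply/eqP; rewrite -Jx eq_sym -subr_eq0 -Kx /K !mulmxDl mul1mx mulNmx.
  by rewrite addrAC.
have [c_le0 xE] := max_principle i Px.
have [c_ge0 _] : - c <= 0 /\ (- c = 0 -> forall i j, (- x) i 0 = (- x) j 0).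
  apply: (max_principle i); rewrite mulmxN Px opprD; congr (_ + _).
  by apply/matrixP => k l; rewrite !mxE.
have c0 : c = 0 by apply/eqP; rewrite eq_le c_le0 -oppr_le0.
rewrite -c0 /c (eq_bigr (fun=> n%:R^-1 * x i 0)) => [|j _].
  by rewrite -mulr_suml sum_const_inv // mul1r.
by rewrite (xE c0 j i).
Qed.

(* [Z] has all its rows equal to the stationary distribution of [P]. *)
Lemma stationary_projection (U : divringClosed R) : P \is a mxOver U ->
  exists Z : 'M[R]_n, [/\ Z \is a mxOver U, Z *m J_mx R n = J_mx R n,
    J_mx R n *m Z = Z & Z *m P = Z].
Proof.
move=> PU; have Ku := fundamental_unitmx.
have KU : K \is a mxOver U by rewrite rpredD ?rpredB ?one_over ?J_mx_over.
have KJ : K *m J_mx R n = J_mx R n.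
  rewrite !mulmxDl mul1mx mulNmx J_mx_idem.
  by rewrite (row_sum1_mulJ P).1 // subrr add0r.
have ZJ : J_mx R n *m invmx K *m J_mx R n = J_mx R n.
  by rewrite -{2}KJ mulmxA mulmxKV // J_mx_idem.
exists (J_mx R n *m invmx K); split=> //.
- by rewrite mxOverM ?J_mx_over ?invmx_over.
- by rewrite mulmxA J_mx_idem.
(* With [Z = J K^-1], expanding [Z K = J] gives [Z - Z P + J = J]. *)
- have := mulmxKV Ku (J_mx R n); rewrite {2}/K mulmxDr ZJ mulmxBr mulmx1.
  by rewrite -[RHS]add0r => /addIr/eqP; rewrite subr_eq0 eq_sym => /eqP.
Qed.

End Stationary.

(** * The segment from [P] to its doubly stochastic end *)

Section Path.
Variables (R : realFieldType) (n : nat) (P : 'M[R]_n).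
Let J := J_mx R n.

Definition segment (t : R) : 'M[R]_n := P + t *: (J *m (1%:M - P)).

Lemma segment0 : segment 0 = P.
Proof. by rewrite /segment scale0r addr0. Qed.

Lemma segment1 : segment 1 = P + J *m (1%:M - P).
Proof. by rewrite /segment scale1r. Qed.

Lemma segment_convex t : segment t = (1 - t) *: P + t *: segment 1.
Proof.
by rewrite segment1 /segment scalerDr addrA -scalerDl subrK scale1r.
Qed.

Lemma segment_over (U : divringClosed R) t :
  P \is a mxOver U -> t \in U -> segment t \is a mxOver U.
Proof.
move=> PU tU; rewrite rpredD // mxOverZ // mxOverM ?J_mx_over //.
by rewrite rpredB // one_over.
Qed.

Lemma sub1_segment t :
  1%:M - segment t = (1%:M - t *: J) *m (1%:M - P).
Proof.
by rewrite /segment opprD addrA mulmxBl mul1mx -scalemxAl.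
Qed.

(** The distances to the end multiply: the new parameter is [1 - (1 - s) * (1 - t)]. *)
Lemma segment_step s t :
  segment s + (t *: J) *m (1%:M - segment s) = segment (s + t - t * s).
Proof.
have tJ : (t *: J) *m (1%:M - s *: J) = (t - t * s) *: J.
  rewrite mulmxBr mulmx1 -scalemxAl -scalemxAr J_mx_idem scalerA.
  by rewrite -scalerBl.
by rewrite sub1_segment mulmxA tJ -scalemxAl -addrA -scalerDl -addrA.
Qed.

Hypothesis PJ : P *m J = J.

Lemma segmentJ t : segment t *m J = J.
Proof.
by rewrite mulmxDl -scalemxAl -mulmxA mulmxBl mul1mx PJ subrr mulmx0 scaler0
  addr0.
Qed.

Lemma Jsegment1 : J *m segment 1 = J.
Proof.
by rewrite segment1 mulmxDr mulmxA J_mx_idem -mulmxDr addrC subrK mulmx1.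
Qed.

(** The term [b *: J] is killed by [1%:M - J], and [Z *m (1%:M - P) = 0] leaves only
    [- t *: (J *m (1%:M - P))]. *)
Lemma segment1_step (Z : 'M[R]_n) (b t : R) :
    Z *m J = J -> J *m Z = Z -> Z *m P = Z ->
  segment 1 + (t *: (Z + b *: J)) *m (1%:M - segment 1) = segment (1 - t).
Proof.
move=> ZJ JZ ZP; have ZbJ : (t *: (Z + b *: J)) *m (1%:M - J) = t *: (Z - J).
  rewrite -scalemxAl mulmxBr mulmx1 mulmxDl ZJ -scalemxAl J_mx_idem.
  by rewrite opprD addrACA subrr addr0.
rewrite sub1_segment scale1r mulmxA ZbJ -scalemxAl mulmxBl [Z *m _]mulmxBr.
by rewrite mulmx1 ZP subrr sub0r scalerN -scaleNr -addrA -scalerDl.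
Qed.

Variable U : divringClosed R.
Hypotheses (PU : P \is a mxOver U) (P0 : mx_nonneg P).
Hypothesis Q0 : mx_nonneg (segment 1).

Lemma segment_nonneg t : 0 <= t <= 1 -> mx_nonneg (segment t).
Proof.
case/andP=> t0 t1 i j; rewrite segment_convex [leRHS]mxE.
by rewrite addr_ge0 // [leRHS]mxE mulr_ge0 // subr_ge0.
Qed.

Lemma segment_ESSE m i : (0 < m)%N ->
    (forall k l, (J *m P) k l <= m%:R * P k l) ->
    (forall k l, (J *m segment 1) k l <= m%:R * segment 1 k l) ->
  ESSE (nonneg_part U) (segment (i%:R / (m + i)%:R))
    (segment (i.+1%:R / (m + i.+1)%:R)).
Proof.
move=> m0 JP JQ; set s := i%:R / _.
have k0 : (m + i)%:R != 0 :> R by rewrite pnatr_eq0 -lt0n addn_gt0 m0.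
have k1 : (m + i.+1)%:R != 0 :> R by rewrite pnatr_eq0 addnS.
have s01 : 0 <= s <= 1.
  rewrite divr_ge0 //= ler_pdivrMr ?mul1r ?ler_nat ?leq_addl //.
  by rewrite lt0r k0 ler0n.
(* The bound is linear in the matrix, so it passes from both ends to the whole segment. *)
have JC k l : (J *m segment s) k l <= m%:R * segment s k l.
  rewrite segment_convex mulmxDr -!scalemxAr [in leLHS]mxE [X in _ <= _ * X]mxE.
  rewrite mulrDr; apply: lerD; rewrite [in leLHS]mxE [X in _ <= _ * X]mxE.
    by rewrite mulrCA ler_wpM2l // subr_ge0; case/andP: s01.
  by rewrite mulrCA ler_wpM2l //; case/andP: s01.
have sU : s \in U by rewrite rpredM ?rpredV ?rpred_nat.
set t : R := (m + i.+1)%:R^-1.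
have tU : t \in U by rewrite rpredV rpred_nat.
(* Here [1 - s = m / (m + i)] and [1 - t = (m + i) / (m + i + 1)], so the product telescopes. *)
have -> : i.+1%:R / (m + i.+1)%:R = s + t - t * s.
  rewrite /s /t; move: k0 k1; rewrite addnS -!natr1 natrD => k0 k1.
  by field; rewrite k0 k1.
rewrite -segment_step; apply: (ESSE_step (s := t)) => //.
- exact: segment_over.
- by rewrite mxOverZ ?J_mx_over.
- by rewrite -scalemxAr segmentJ.
- by rewrite -scalemxAl -scalemxAr J_mx_idem.
- by rewrite invf_lt1 ?ltr1n ?addnS ?ltnS ?addn_gt0 ?m0.
- by move=> k l; rewrite !mxE mulr_ge0 // invr_ge0.
- apply: nonneg_1subZ => [|k l]; first by rewrite lt0r k1 ler0n.
  apply: le_trans (JC k l) _; rewrite ler_wpM2r ?ler_nat ?leq_addr //.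
  exact: segment_nonneg.
Qed.

End Path.

(** * Similarity of [P] and [Q], and the chain between them *)

Theorem theorem3p3 (R : realType) (U : divringClosed R) (n : nat)
    (P : 'M[R]_n)
    (P_over : P \is a mxOver U)
    (P_pos : mx_positive P)
    (P_stoch : stochastic P)
    (PJ_pos : mx_positive (P + J_mx R n *m (1%:M - P))) :
  exists Q : 'M[R]_n,
    [/\ mx_positive Q, doubly_stochastic Q, similar_over U P Q
      & SSE_same_size (nonneg_part U) P Q].
Proof.
have [P0 P1] := P_stoch.
have PJ := (row_sum1_mulJ P).1 P1.
have [Z [ZU ZJ JZ ZP]] := stationary_projection P_pos P1 P_over.
have PZ : P *m Z = Z by rewrite -JZ mulmxA PJ.
have ZZ : Z *m Z = Z by rewrite -{2}JZ mulmxA ZJ JZ.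
set J := J_mx R n in PJ_pos PJ ZJ JZ.
pose Q := segment P 1.
have Q_pos : mx_positive Q by rewrite /Q segment1.
have Q0 : mx_nonneg Q by move=> i j; rewrite ltW.
have QJ : Q *m J = J by apply: segmentJ.
have JQ : J *m Q = J by apply: Jsegment1.
have QU : Q \is a mxOver U by rewrite segment_over ?rpred1.
have J_pos : mx_positive J.
  by move=> i j; rewrite mxE invr_gt0 ltr0n (leq_ltn_trans _ (ltn_ord i)).
exists Q; split=> //.
- split; split=> //; first exact/row_sum1_mulJ.
    by move=> i j; rewrite mxE.
  by apply/row_sum1_mulJ; rewrite -[J_mx R n]tr_J_mx -trmx_mul -/J JQ.
- pose D := J - Z.
  (* As [D] squares to zero, [1%:M + D] inverts [1%:M - D]. *)
  have DD : D *m D = 0.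
    by rewrite mulmxBl !mulmxBr J_mx_idem ZJ JZ ZZ subrr.
  have D_unit : 1%:M - D \in unitmx.
    have : (1%:M - D) *m (1%:M + D) = 1%:M.
      by rewrite mulmxBl mul1mx mulmxDr mulmx1 DD addr0 addrK.
    by case/mulmx1_unit.
  exists (1%:M - D); first by rewrite inE D_unit !rpredB ?one_over ?J_mx_over.
  apply/(simmxP D_unit); rewrite conj_step; last by rewrite mulmxBr PJ PZ.
  rewrite /Q segment1 -/J; congr ((_ + _) *m _).
  by rewrite mulmxBl [Z *m _]mulmxBr mulmx1 ZP subrr subr0.
have [N1 JP_le] := positive_mx_dominates (J *m P) P_pos.
have [N2 JQ_le] := positive_mx_dominates (J *m Q) Q_pos.
(* The successor keeps the denominators [m + i] nonzero, even at [i = 0]. *)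
pose m := (N1 + N2).+1.
have [b Z_le] := positive_mx_dominates (- Z) J_pos.
(* Adding [b J] spares us from proving that [Z] itself is nonnegative. *)
pose M := Z + b%:R *: J.
have M0 : mx_nonneg M.
  move=> i j; have := Z_le b (leqnn _) i j.
  by rewrite mxE lerNl -subr_ge0 opprK !mxE addrC.
have MM : M *m M = b.+1%:R *: M.
  rewrite mulmxDl !mulmxDr -!scalemxAl -!scalemxAr ZZ ZJ JZ J_mx_idem.
  by rewrite -scalerDr -natr1 scalerDl scale1r addrC.
have [N3 MQ_le] := positive_mx_dominates (m%:R *: M *m Q) Q_pos.
(* The summand [m * b.+1] makes the scalar [s = m * b.+1 / (m + l)] less than 1; [N3] makes
   [(1%:M - (m / (m + l)) *: M) *m Q] nonnegative. *)
pose l := (N3 + m * b.+1)%N; pose k : R := (m + l)%:R.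
have k_gt0 : 0 < k by rewrite ltr0n.
pose path i := segment P (i%:R / (m + i)%:R).
have last_step : ESSE (nonneg_part U) Q (path l).
  have -> : path l = segment P (1 - k^-1 * m%:R).
    congr segment; apply: (mulIf (lt0r_neq0 k_gt0)).
    rewrite divfK ?lt0r_neq0 // mulrBl mul1r mulrAC mulVf ?lt0r_neq0 //.
    by rewrite mul1r /k natrD addrC addKr.
  rewrite -(segment1_step b%:R _ ZJ JZ ZP) -/M -/Q.
  apply: (ESSE_step (s := k^-1 * m%:R * b.+1%:R)) => //.
  - rewrite mxOverZ ?rpredM ?rpredV ?rpred_nat //.
    by rewrite rpredD // mxOverZ ?rpred_nat ?J_mx_over.
  - by rewrite !rpredM ?rpredV ?rpred_nat.
  - by rewrite -scalemxAr mulmxDr -scalemxAr QJ -JZ mulmxA QJ JZ.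
  - by rewrite -scalemxAl -scalemxAr MM !scalerA mulrAC mulrA.
  - rewrite -mulrA -natrM mulrC ltr_pdivrMr // mul1r ltr_nat /l addnA.
    by rewrite -[ltnLHS]add0n ltn_add2r.
  - by move=> i j; rewrite mxE mulr_ge0 // mulr_ge0 // invr_ge0 ltW.
  - rewrite -scalerA; apply: nonneg_1subZ => // i j.
    by apply: MQ_le; rewrite /l addnCA leq_addr.
(* There are [l] forward steps along [path], then the step from [Q] back to [path l], read in
   reverse. *)
exists l.+1, (fun i => if (i <= l)%N then path i else Q); split.
- by rewrite /path mul0r segment0.
- by rewrite ltnn.
- move=> i _; apply: mxOver_nonneg_part; case: ifP => // _.
    by rewrite segment_over // rpredM ?rpredV ?rpred_nat.
  apply: segment_nonneg => //; rewrite divr_ge0 //=.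
  by rewrite ler_pdivrMr ?ltr0n // mul1r ler_nat leq_addl.
- move=> i; rewrite ltnS => le_il; rewrite le_il; case: ltnP => [lt_il|le_li].
    apply: segment_ESSE => // [p q|p q].
      by apply: JP_le; rewrite /m -addnS leq_addr.
    by apply: JQ_le; rewrite /m -addSn leq_addl.
  have -> : i = l by apply/eqP; rewrite eqn_leq le_il.
  exact: ESSE_sym.
Qed.
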